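(* Let $X_1,X_2$ be locally convex topological vector (LCTV) spaces, and let $\Omega_i\subset X_i$, $i=1,2$, be nonempty compact convex sets. Let $f\colon\Omega_1\times\Omega_2\to\mathbb{R}$ satisfy the following conditions: (a) $f(\cdot,y)$ is concave and upper semicontinuous (on $\Omega_1$) for every fixed $y\in\Omega_2$; (b) $f(x,\cdot)$ is convex and lower semicontinuous (on $\Omega_2$) for every fixed $x\in\Omega_1$. Then we have the minimax equality $$\max_{x\in\Omega_1}\min_{y\in\Omega_2}f(x,y)=\min_{y\in\Omega_2}\max_{x\in\Omega_1}f(x,y).$$ Furthermore, the function $f$ admits a saddle point $(\bar x,\bar y)\in\Omega_1\times\Omega_2$.
   Context: All vector spaces are over $\mathbb{R}$, and LCTV spaces are assumed Hausdorff. A real-valued function $g$ on a subset $\Omega$ of an LCTV space is lower semicontinuous on $\Omega$ if for each $\alpha\in\mathbb{R}$ the set $\{x\in\Omega\mid g(x)\le\alpha\}$ is closed in $\Omega$ with the induced topology, and upper semicontinuous if $-g$ is lower semicontinuous. Writing $\max$ and $\min$ means that the corresponding supremum and infimum are attained. A saddle point for $f$ is a pair $(\bar x,\bar y)\in\Omega_1\times\Omega_2$ such that $f(x,\bar y)\le f(\bar x,\bar y)\le f(\bar x,y)$ for all $x\in\Omega_1$ and $y\in\Omega_2$. *)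

(* Defs.v *)
From HB Require Import structures.
From mathcomp Require Import all_boot all_order all_algebra.
From mathcomp Require Import all_classical all_reals all_analysis.
Import Order.TTheory GRing.Theory Num.Theory.
Import numFieldNormedType.Exports.

Set Implicit Arguments.
Unset Strict Implicit.
Unset Printing Implicit Defensive.

Local Open Scope classical_set_scope.
Local Open Scope ring_scope.

(* A function on a subset D is represented by a total function on the ambient
   type; none of the definitions below depends on its values outside D. *)

(* [subspace D] has the open sets whose trace on D is relatively open, so
   being closed there means being closed in D for the induced topology
   (see [closed_subspaceP]). *)
Definition lsc_on (R : realType) (X : topologicalType) (D : set X)
    (g : X -> R) : Prop :=
  forall a : R, closed ([set x | D x /\ g x <= a] : set (subspace D)).

Definition usc_on (R : realType) (X : topologicalType) (D : set X)
    (g : X -> R) : Prop :=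
  lsc_on D (fun x => - g x).

Definition concave_function (R : realType) (E : lmodType R) (D : set E)
    (g : E -> R) : Prop :=
  convex_function D (fun x => - g x).

(* [sup] and [inf] return a default value on empty or unbounded sets, hence
   the [has_sup] and [has_inf] conjuncts. *)
Definition sup_attained (R : realType) (A : set R) : Prop :=
  has_sup A /\ A (sup A).

Definition inf_attained (R : realType) (A : set R) : Prop :=
  has_inf A /\ A (inf A).

Definition saddle_point (R : realType) (X1 X2 : Type) (O1 : set X1)
    (O2 : set X2) (f : X1 -> X2 -> R) (xb : X1) (yb : X2) : Prop :=
  [/\ O1 xb, O2 yb & forall x y, O1 x -> O2 y ->
    f x yb <= f xb yb /\ f xb yb <= f xb y].

(* Main.v *)
Require Import Defs.
From HB Require Import structures.
From mathcomp Require Import all_boot all_order all_algebra.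
From mathcomp Require Import all_classical all_reals all_analysis.
From mathcomp Require Import ring lra.
Import Order.TTheory GRing.Theory Num.Theory.
Import numFieldNormedType.Exports.

Set Implicit Arguments.
Unset Strict Implicit.
Unset Printing Implicit Defensive.

Local Open Scope classical_set_scope.
Local Open Scope ring_scope.

(** The heart of the matter is an alternative, [minimax_alternative]: for each
    level c, either some y keeps f(., y) below c on O1, or some x keeps f(x, .)
    above c on O2. If the first case fails, the compact sets
    {y in O2 | f(x, y) <= c}, x in O1, have empty intersection, so finitely
    many of them already do ([compact_lsc_system]): there are x_1, ..., x_n
    in O1 with max_i f(x_i, y) >= c for all y in O2. A purely algebraic
    argument then replaces x_1, ..., x_n by a single point x of O1 with
    f(x, .) >= c on O2 ([finite_concave_convex_minimax]). It is an induction
    on n whose step treats two points x_1, x_2 by means of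
    [convex_comb_ge_of_max_ge]: two convex functions whose maximum is at least
    c have a convex combination that is at least c, and concavity of f(., y)
    bounds f at the same combination of x_1 and x_2 from below. The
    two-function statement amounts to separating a planar convex set from an
    open quadrant, which only needs an infimum of reals; no topology and no
    separation theorem in the ambient spaces enters.

    The rest is semicontinuity. The function lo(x) = min_y f(x, y) is upper
    semicontinuous and up(y) = max_x f(x, y) is lower semicontinuous, hence lo
    has a maximizer xb and up has a minimizer yb, with
    lo(xb) <= f(xb, yb) <= up(yb). A level c strictly between lo(xb) and up(yb)
    would contradict both cases of the alternative, so these three numbers are
    equal; this is the minimax equality, and it makes (xb, yb) a saddle
    point. *)

(** * Convex and concave functions *)

Lemma convex_set_comb (R : realType) (E : lmodType R) (C : set E) (x y : E)
    (t : R) :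
  convex_set C -> C x -> C y -> 0 <= t -> t <= 1 ->
  C (t *: x + (1 - t) *: y).
Proof.
move=> cC Cx Cy t0 t1.
by have := cC x y (Itv01 t0 t1) (mem_set Cx) (mem_set Cy); rewrite inE.
Qed.

Lemma convex_function_comb (R : realType) (E : lmodType R) (C : set E)
    (g : E -> R) (x y : E) (t : R) :
  convex_function C g -> C x -> C y -> 0 <= t -> t <= 1 ->
  g (t *: x + (1 - t) *: y) <= t * g x + (1 - t) * g y.
Proof.
move=> cg Cx Cy t0 t1.
exact: (cg (Itv01 t0 t1) x y (mem_set Cx) (mem_set Cy)).
Qed.

Lemma concave_function_comb (R : realType) (E : lmodType R) (C : set E)
    (g : E -> R) (x y : E) (t : R) :
  concave_function C g -> C x -> C y -> 0 <= t -> t <= 1 ->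
  t * g x + (1 - t) * g y <= g (t *: x + (1 - t) *: y).
Proof.
move=> cg Cx Cy t0 t1.
have := convex_function_comb cg Cx Cy t0 t1; lra.
Qed.

Lemma convex_function_sub (R : realType) (E : lmodType R) (C D : set E)
    (g : E -> R) :
  D `<=` C -> convex_function C g -> convex_function D g.
Proof.
move=> DC cg t x y /set_mem Dx /set_mem Dy.
by apply: cg; apply/mem_set/DC.
Qed.

Lemma convex_strict_sublevel (R : realType) (E : lmodType R) (C : set E)
    (g : E -> R) (c : R) :
  convex_set C -> convex_function C g ->
  convex_set [set x | C x /\ g x < c].
Proof.
move=> cC cg; apply/convex_setW => x y.
move=> /set_mem[Cx gx] /set_mem[Cy gy] k k0 k1; apply/mem_set.
have k0' := ltW k0; have k1' := ltW k1.
split; first exact: (convex_set_comb cC Cx Cy k0' k1').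
apply: le_lt_trans (convex_function_comb cg Cx Cy k0' k1') _; nra.
Qed.

(** The requirement on t is, at points where g1 < c, an upper bound
    t <= phi = (g2 - c) / (g2 - g1), and, at points where g2 < c, a lower bound
    t >= (c - g2) / (g1 - g2). Such a t exists once every lower bound is below
    every upper bound. If this failed for y and z, then at a suitable point of
    the segment [y, z] convexity would make both g1 and g2 smaller than c. *)
Lemma convex_comb_ge_of_max_ge (R : realType) (E : lmodType R) (C : set E)
    (g1 g2 : E -> R) (c : R) :
  convex_set C -> convex_function C g1 -> convex_function C g2 ->
  (forall y, C y -> c <= g1 y \/ c <= g2 y) ->
  exists t : R, [/\ 0 <= t, t <= 1 &
    forall y, C y -> c <= t * g1 y + (1 - t) * g2 y].
Proof.
move=> cC cg1 cg2 g12.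
have g2_ge y : C y -> g1 y < c -> c <= g2 y.
  by move=> Cy g1y; case: (g12 y Cy) => //; rewrite leNgt g1y.
have [[y0 [Cy0 g1y0]]|noA] := pselect (exists y, C y /\ g1 y < c); last first.
  exists 1; split=> // y Cy; rewrite subrr mul1r mul0r addr0 leNgt.
  by apply/negP => g1y; apply: noA; exists y.
pose phi y := (g2 y - c) / (g2 y - g1 y).
pose S := [set phi y | y in [set y | C y /\ g1 y < c]].
have S0 : S (phi y0) by exists y0.
have S_lb0 : lbound S 0.
  move=> _ [y [Cy g1y] <-]; have := g2_ge y Cy g1y => g2y.
  by rewrite divr_ge0 // subr_ge0 // (le_trans (ltW g1y)).
have t_le y : C y -> g1 y < c -> inf S <= phi y.
  by move=> Cy g1y; apply: ge_inf; [exists 0 | exists y].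
have t1 : inf S <= 1.
  apply: le_trans (t_le _ Cy0 g1y0) _; have g2y0 := g2_ge _ Cy0 g1y0.
  rewrite /phi ler_pdivrMr; lra.
have t0 : 0 <= inf S by apply: lb_le_inf => //; exists (phi y0).
exists (inf S); split=> // z Cz.
have [g1z|g1z] := ltP (g1 z) c.
  have := t_le z Cz g1z; have g2z := g2_ge z Cz g1z.
  rewrite /phi ler_pdivlMr; lra.
have [g2z|g2z] := ltP (g2 z) c; last by nra.
suff : (c - g2 z) / (g1 z - g2 z) <= inf S by rewrite ler_pdivrMr; lra.
apply: lb_le_inf; first by exists (phi y0).
move=> _ [y [Cy g1y] <-]; have g2y := g2_ge y Cy g1y.
rewrite /phi ler_pdivrMr; last by lra.
rewrite mulrAC ler_pdivlMr; last by lra.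
rewrite leNgt; apply/negP => lt_ratio.
(* With the notation below the failure reads b * p < d * a, and the weight
   (p + d) / (a + b + p + d) on y equalizes the convexity bounds of g1 and g2:
   both become c - (d * a - b * p) / (a + b + p + d). *)
have [a [aE a0]] : exists a, g1 y = c - a /\ 0 < a by exists (c - g1 y); lra.
have [b [bE b0]] : exists b, g2 y = c + b /\ 0 <= b by exists (g2 y - c); lra.
have [p [pE p0]] : exists p, g1 z = c + p /\ 0 <= p by exists (g1 z - c); lra.
have [d [dE d0]] : exists d, g2 z = c - d /\ 0 < d by exists (c - g2 z); lra.
have bp_lt : b * p < d * a by nra.
pose u := a + b + p + d.
have u0 : 0 < u by rewrite /u; lra.
have s0 : 0 <= (p + d) / u by rewrite divr_ge0; lra.
have s1 : (p + d) / u <= 1 by rewrite ler_pdivrMr // /u; lra.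
have Cw := convex_set_comb cC Cy Cz s0 s1.
have onem_s : 1 - (p + d) / u = (a + b) / u.
  by rewrite /u; field; lra.
have := convex_function_comb cg1 Cy Cz s0 s1.
have := convex_function_comb cg2 Cy Cz s0 s1.
rewrite onem_s aE bE pE dE.
have -> : (p + d) / u * (c + b) + (a + b) / u * (c - d) =
          c - (d * a - b * p) / u by rewrite /u; field; lra.
have -> : (p + d) / u * (c - a) + (a + b) / u * (c + p) =
          c - (d * a - b * p) / u by rewrite /u; field; lra.
have : 0 < (d * a - b * p) / u by rewrite divr_gt0 // subr_gt0.
rewrite -onem_s; case: (g12 _ Cw); lra.
Qed.

(** Induction on s, with C generalized: the hypothesis for the tail of s holds
    on the convex part of C where f x1 < c, which yields a point x2 with
    f x2 >= c there, hence max (f x1) (f x2) >= c on all of C. *)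
Lemma finite_concave_convex_minimax (R : realType) (E1 E2 : lmodType R)
    (O1 : set E1) (C : set E2) (f : E1 -> E2 -> R) (c : R) (s : seq E1) :
  O1 !=set0 -> convex_set O1 -> convex_set C ->
  (forall y, C y -> concave_function O1 (f^~ y)) ->
  (forall x, O1 x -> convex_function C (f x)) ->
  (forall x, x \in s -> O1 x) ->
  (forall y, C y -> exists2 x, x \in s & c <= f x y) ->
  exists2 x, O1 x & forall y, C y -> c <= f x y.
Proof.
move=> [x0 O1x0] cO1.
elim: s C => [|x1 s IH] C cC fconc fconv sO1 fs.
  by exists x0 => // y /fs[].
have O1x1 : O1 x1 by apply: sO1; rewrite mem_head.
pose C' := [set y | C y /\ f x1 y < c].
have C'C : C' `<=` C by move=> y [].
have [||||y [Cy f1y]|x2 O1x2 fx2] := IH C'.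
- exact: convex_strict_sublevel (fconv _ O1x1).
- by move=> y /C'C; apply: fconc.
- by move=> x /fconv; apply: convex_function_sub.
- by move=> x xs; apply: sO1; rewrite inE xs orbT.
- have [x] := fs y Cy; rewrite inE => /predU1P[->|xs cfx]; last by exists x.
  by rewrite leNgt f1y.
have [|t [t0 t1 ft]] :=
  convex_comb_ge_of_max_ge (c := c) cC (fconv _ O1x1) (fconv _ O1x2).
  move=> y Cy; have [f1y|] := ltP (f x1 y) c; last by left.
  by right; apply: fx2.
exists (t *: x1 + (1 - t) *: x2); first exact: convex_set_comb.
move=> y Cy; apply: le_trans (ft y Cy) _.
exact: (concave_function_comb (fconc y Cy)).
Qed.

(** * Lower semicontinuous functions on a compact set *)

(** The finite intersection property, for the sublevel sets {h i <= c i}. They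
    are closed in K only, so each is first extended to a closed set of T. *)
Lemma compact_lsc_system (R : realType) (T : topologicalType) (I : choiceType)
    (K : set T) (D : set I) (h : I -> T -> R) (c : I -> R) :
  compact K -> (forall i, D i -> lsc_on K (h i)) ->
  (forall s : seq I, (forall i, i \in s -> D i) ->
    exists2 x, K x & forall i, i \in s -> h i x <= c i) ->
  exists2 x, K x & forall i, D i -> h i x <= c i.
Proof.
move=> cK hlsc hfin.
have [[i0 Di0]|noD] := pselect (D !=set0); last first.
  have [//|x Kx _] := hfin [::].
  by exists x => // i Di; case: noD; exists i.
pose F i := [set x | K x /\ h i x <= c i].
have Ffin : finI D F.
  move=> D' D'D.
  have [|x Kx hx] := hfin (finmap.enum_fset D').
    by move=> i iD'; have := D'D i iD'; rewrite inE.
  by exists x => i /= iD'; split=> //; apply: hx.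
have FF := finI_filter Ffin.
have FK : filter_from (finI_from D F) id K.
  by exists (F i0); [apply: finI_from1 | move=> x []].
have [p [Kp clp]] := cK _ FF FK.
exists p => // i Di.
have /closed_subspaceP [V clV VK] := hlsc i Di (c i).
have : F i p; last by case.
suff Vp : V p.
  have : (V `&` K) p by [].
  by rewrite VK => -[].
apply: clV => B Bp; apply: clp => //.
exists (F i); first exact: finI_from1.
move=> x Fx.
have : ([set x | K x /\ h i x <= c i] `&` K) x by split=> //; case: Fx.
by rewrite -VK => -[].
Qed.

(** A minimizer is a common solution of the inequalities g x <= a, for a
    ranging over the values of g: any finite number of them is solved by the
    point realizing the smallest of the a. *)
Lemma compact_lsc_min (R : realType) (T : topologicalType) (K : set T)
    (g : T -> R) :
  K !=set0 -> compact K -> lsc_on K g ->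
  exists2 x, K x & forall y, K y -> g x <= g y.
Proof.
move=> [x0 Kx0] cK glsc.
have [s gs|x Kx gx] :=
  @compact_lsc_system _ _ R K (g @` K) (fun=> g) id cK (fun _ _ => glsc).
  elim: s gs => [_|a s IH gs]; first by exists x0.
  have [i is_|x Kx gx] := IH; first by apply: gs; rewrite inE is_ orbT.
  have [x1 Kx1 gx1] := gs a (mem_head _ _).
  have [le|/ltW le] := leP (g x) a.
    by exists x => // i; rewrite inE => /predU1P[->|/gx].
  exists x1 => // i; rewrite inE gx1 => /predU1P[->//|/gx].
  exact: le_trans.
by exists x => // y Ky; apply: gx; exists y.
Qed.

Lemma compact_usc_max (R : realType) (T : topologicalType) (K : set T)
    (g : T -> R) :
  K !=set0 -> compact K -> usc_on K g ->
  exists2 x, K x & forall y, K y -> g y <= g x.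
Proof.
move=> K0 cK /(compact_lsc_min K0 cK)[x Kx gx].
by exists x => // y /gx; rewrite lerN2.
Qed.

(** A sublevel set of the supremum is the intersection of the corresponding
    sublevel sets. The bound is needed because [sup] takes a default value on
    unbounded sets. *)
Lemma lsc_on_sup (R : realType) (T : topologicalType) (I : Type) (K : set T)
    (J : set I) (h : I -> T -> R) :
  J !=set0 -> (forall i, J i -> lsc_on K (h i)) ->
  (forall x, K x -> has_ubound [set h i x | i in J]) ->
  lsc_on K (fun x => sup [set h i x | i in J]).
Proof.
move=> [i0 Ji0] hlsc hub a.
rewrite (_ : [set x | _] = \bigcap_(i in J) [set x | K x /\ h i x <= a]).
  by apply: closed_bigI => i Ji; apply: hlsc.
apply/seteqP; split=> [x [Kx supx] i Ji|x hx].
  split=> //; apply: le_trans supx.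
  by apply: ub_le_sup; [apply: hub | exists i].
have [Kx _] := hx i0 Ji0.
split=> //; apply: ge_sup; first by exists (h i0 x), i0.
by move=> _ [i Ji <-]; have [] := hx i Ji.
Qed.

Lemma usc_on_inf (R : realType) (T : topologicalType) (I : Type) (K : set T)
    (J : set I) (h : I -> T -> R) :
  J !=set0 -> (forall i, J i -> usc_on K (h i)) ->
  (forall x, K x -> has_lbound [set h i x | i in J]) ->
  usc_on K (fun x => inf [set h i x | i in J]).
Proof.
move=> J0 husc hlb.
have -> : usc_on K (fun x => inf [set h i x | i in J]) =
          lsc_on K (fun x => sup [set - h i x | i in J]).
  by congr lsc_on; apply/funext => x; rewrite /inf opprK image_comp.
apply: lsc_on_sup => // x /hlb /has_lb_ubN.
by rewrite image_comp.
Qed.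

(** * The minimax theorem *)

Lemma min_inf (R : realType) (T : Type) (A : set T) (g : T -> R) (x : T) :
  A x -> (forall y, A y -> g x <= g y) ->
  inf_attained [set g y | y in A] /\ inf [set g y | y in A] = g x.
Proof.
move=> Ax gx.
have lb : lbound [set g y | y in A] (g x) by move=> _ [y Ay <-]; apply: gx.
have hi : has_inf [set g y | y in A] by split; [exists (g x), x | exists (g x)].
have infE : inf [set g y | y in A] = g x.
  apply/eqP; rewrite eq_le lb_le_inf //; last by case: hi.
  by rewrite ge_inf //; [case: hi | exists x].
by split=> //; split=> //; rewrite infE; exists x.
Qed.

Lemma max_sup (R : realType) (T : Type) (A : set T) (g : T -> R) (x : T) :
  A x -> (forall y, A y -> g y <= g x) ->
  sup_attained [set g y | y in A] /\ sup [set g y | y in A] = g x.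
Proof.
move=> Ax gx.
have ub : ubound [set g y | y in A] (g x) by move=> _ [y Ay <-]; apply: gx.
have hs : has_sup [set g y | y in A] by split; [exists (g x), x | exists (g x)].
have supE : sup [set g y | y in A] = g x.
  apply/eqP; rewrite eq_le ge_sup //; last by case: hs.
  by rewrite ub_le_sup //; [case: hs | exists x].
by split=> //; split=> //; rewrite supE; exists x.
Qed.

(** The inequalities are weak in both cases, so that the algebraic finite
    version applies without any slack; they are strong enough because the
    level c can be chosen strictly inside a hypothetical duality gap. *)
Lemma minimax_alternative (R : realType) (E1 : lmodType R)
    (E2 : preTopologicalLmodType R) (O1 : set E1) (O2 : set E2)
    (f : E1 -> E2 -> R) (c : R) :
  O1 !=set0 -> convex_set O1 -> convex_set O2 -> compact O2 ->
  (forall y, O2 y -> concave_function O1 (f^~ y)) ->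
  (forall x, O1 x -> convex_function O2 (f x)) ->
  (forall x, O1 x -> lsc_on O2 (f x)) ->
  (exists2 y, O2 y & forall x, O1 x -> f x y <= c) \/
  (exists2 x, O1 x & forall y, O2 y -> c <= f x y).
Proof.
move=> O10 cO1 cO2 kO2 fconc fconv flsc.
have [|noy] := pselect (exists2 y, O2 y & forall x, O1 x -> f x y <= c).
  by left.
right; apply: contrapT => nox; apply: noy.
apply: (compact_lsc_system kO2 flsc) => s sO1.
apply: contrapT => nos; apply: nox.
apply: (finite_concave_convex_minimax O10 cO1 cO2 fconc fconv sO1) => y O2y.
apply: contrapT => nox; apply: nos; exists y => // x xs.
by rewrite leNgt; apply/negP => /ltW cf; apply: nox; exists x.
Qed.

Theorem corollary5p2 (R : realType) (X1 X2 : tvsType R)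
    (hX1 : hausdorff_space X1) (hX2 : hausdorff_space X2)
    (O1 : set X1) (O2 : set X2)
    (O1_neq0 : O1 !=set0) (O1_compact : compact O1) (O1_convex : convex_set O1)
    (O2_neq0 : O2 !=set0) (O2_compact : compact O2) (O2_convex : convex_set O2)
    (f : X1 -> X2 -> R)
    (fa : forall y, O2 y ->
      concave_function O1 (fun x => f x y) /\ usc_on O1 (fun x => f x y))
    (fb : forall x, O1 x ->
      convex_function O2 (fun y => f x y) /\ lsc_on O2 (fun y => f x y)) :
  [/\ forall x, O1 x -> inf_attained [set f x y | y in O2],
      sup_attained [set inf [set f x y | y in O2] | x in O1],
      forall y, O2 y -> sup_attained [set f x y | x in O1],
      inf_attained [set sup [set f x y | x in O1] | y in O2] &
      sup [set inf [set f x y | y in O2] | x in O1] =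
      inf [set sup [set f x y | x in O1] | y in O2]]
  /\ exists (xb : X1) (yb : X2), saddle_point O1 O2 f xb yb.
Proof.
have inf_att x : O1 x -> inf_attained [set f x y | y in O2].
  move=> /fb[_ /(compact_lsc_min O2_neq0 O2_compact)[y O2y fy]].
  by have [] := min_inf O2y fy.
have sup_att y : O2 y -> sup_attained [set f x y | x in O1].
  move=> /fa[_ /(compact_usc_max O1_neq0 O1_compact)[x O1x fx]].
  by have [] := max_sup O1x fx.
pose lo x := inf [set f x y | y in O2].
pose up y := sup [set f x y | x in O1].
have lo_le x y : O1 x -> O2 y -> lo x <= f x y.
  by move=> /inf_att[[_ lb] _] O2y; apply: ge_inf => //; exists y.
have le_up x y : O1 x -> O2 y -> f x y <= up y.
  by move=> O1x /sup_att[[_ ub] _]; apply: ub_le_sup => //; exists x.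
have [xb O1xb lo_max] : exists2 x, O1 x & forall x', O1 x' -> lo x' <= lo x.
  apply: compact_usc_max => //; apply: (usc_on_inf O2_neq0) => [y /fa[]//|x].
  by move=> /inf_att[[]].
have [yb O2yb up_min] : exists2 y, O2 y & forall y', O2 y' -> up y <= up y'.
  apply: compact_lsc_min => //; apply: (lsc_on_sup O1_neq0) => [x /fb[]//|y].
  by move=> /sup_att[[]].
have lo_up : lo xb = up yb.
  apply/eqP; rewrite eq_le.
  rewrite (le_trans (lo_le _ _ O1xb O2yb) (le_up _ _ O1xb O2yb)).
  rewrite leNgt; apply/negP => gap.
  have [c lo_c c_up] : exists2 c, lo xb < c & c < up yb.
    by exists ((lo xb + up yb) / 2); lra.
  have [y /fa[]//|x /fb[]//|x /fb[]//|[y O2y fc]|[x O1x cf]] :=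
    minimax_alternative (f := f) c O1_neq0 O1_convex O2_convex O2_compact.
    have : up y <= c.
      apply: ge_sup => [|_ [x O1x <-]]; last exact: fc.
      by case: (sup_att y O2y) => -[].
    have := up_min y O2y; lra.
  have : c <= lo x.
    apply: lb_le_inf => [|_ [y O2y <-]]; last exact: cf.
    by case: (inf_att x O1x) => -[].
  have := lo_max x O1x; lra.
have [sup_lo sup_loE] := max_sup O1xb lo_max.
have [inf_up inf_upE] := min_inf O2yb up_min.
split.
  by split=> //; apply: etrans sup_loE (etrans lo_up (esym inf_upE)).
exists xb, yb; split=> // x y O1x O2y.
have fxy : f xb yb = lo xb.
  by apply/eqP; rewrite eq_le lo_le // lo_up le_up.
split; first by rewrite fxy lo_up le_up.
by rewrite fxy lo_le.
Qed.
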